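(* Let $F$ be a field of characteristic $\neq 2$ and let $(A,* )$ be a nonzero normal symmetric triality algebra over $F$ with respect to the skew-symmetric bilinear map $\delta:A\times A\to\mathfrak{stri}(A,* )$. Let $\delta(A,A)$ denote the linear span of the elements $\delta(x,y)$, $x,y\in A$. Then $\mathfrak t=\sum_{i=0}^2\theta^i\bigl(\delta(A,A)\bigr)$ is a Lie subalgebra of $\mathfrak{stri}(A,* )$, and $\theta^i\bigl(\delta(A,A)\bigr)$ is an ideal of $\mathfrak t$ for any $i=0,1,2$. Moreover, consider three copies $\iota_i(A)$ of $A$ ($i=0,1,2$, indices in $\mathbb Z_3$) and define an anticommutative multiplication on $$\mathfrak g(A,* )=\mathfrak t\oplus\bigl(\oplus_{i=0}^2\iota_i(A)\bigr)$$ by: - $\mathfrak t$ is a subalgebra of $\mathfrak g(A,* )$; - $[(d_0,d_1,d_2),\iota_i(x)]=\iota_i(d_i(x))$ for any $(d_0,d_1,d_2)\in\mathfrak t$, $x\in A$, $i\in\mathbb Z_3$; - $[\iota_i(x),\iota_{i+1}(y)]=\iota_{i+2}(x*y)$ for any $x,y\in A$, $i\in\mathbb Z_3$; - $[\iota_i(x),\iota_i(y)]=\theta^i\bigl(\delta(x,y)\bigr)$ for any $x,y\in A$, $i\in\mathbb Z_3$. Then $\mathfrak g(A,* )$ is a Lie algebra, and the alternating group $A_4$ embeds as a subgroup of $\mathrm{Aut}\,\mathfrak g(A,* )$ by letting its generators $\tau_1,\tau_2,\varphi$ act linearly as follows: - $\tau_1|_{\mathfrak t}=\mathrm{id}=\tau_2|_{\mathfrak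 t}$ and $\varphi|_{\mathfrak t}=\theta|_{\mathfrak t}$; - $\varphi(\iota_i(x))=\iota_{i+1}(x)$ for any $x\in A$, $i\in\mathbb Z_3$; - for any $x\in A$, $\tau_1(\iota_0(x))=\iota_0(x)$ and $\tau_1(\iota_i(x))=-\iota_i(x)$ for $i=1,2$, while $\tau_2(\iota_1(x))=\iota_1(x)$ and $\tau_2(\iota_i(x))=-\iota_i(x)$ for $i=0,2$.
   Context: In $A_4$: $\tau_1=(12)(34)$, $\tau_2=(23)(14)$, $\varphi=(123)$ (i.e. $1\mapsto2\mapsto3\mapsto1$), permutations composed right to left. For an algebra $(A,* )$ (a vector space with a bilinear product), its symmetric triality Lie algebra is $\mathfrak{stri}(A,* )=\{(d_0,d_1,d_2)\in\mathfrak{gl}(A)^3: d_i(x*y)=d_{i+1}(x)*y+x*d_{i+2}(y)\ \text{for all } i\in\mathbb Z_3,\ x,y\in A\}$, a Lie subalgebra of $\mathfrak{gl}(A)^3$ with componentwise bracket, where $\mathfrak{gl}(A)$ is the Lie algebra of all linear endomorphisms of $A$. It has the order $3$ automorphism $\theta:(d_0,d_1,d_2)\mapsto(d_2,d_0,d_1)$. $(A,* )$ is a normal symmetric triality algebra with respect to a skew-symmetric bilinear map $\delta:A\times A\to\mathfrak{stri}(A,* )$, $\delta(x,y)=(\delta_0(x,y),\delta_1(x,y),\delta_2(x,y))$, if for all $a,b,x,y,z\in A$ and $i,j\in\mathbb Z_3$: (i) $[\delta_i(a,b),\delta_j(x,y)]=\delta_j(\delta_{i-j}(a,b)(x),y)+\delta_j(x,\delta_{i-j}(a,b)(y))$;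 (ii) $\delta_0(x,y*z)+\delta_{-1}(y,z*x)+\delta_{-2}(z,x*y)=0$; (iii) $\delta_0(x,y)(z)+\delta_0(y,z)(x)+\delta_0(z,x)(y)=0$; (iv) $\delta_1(x,y)=r_yl_x-r_xl_y$; (v) $\delta_2(x,y)=l_yr_x-l_xr_y$, where $l_x:z\mapsto x*z$ and $r_x:z\mapsto z*x$. *)

(* Defs.v *)
From HB Require Import structures.
From mathcomp Require Import all_boot all_order all_algebra all_fingroup.
From mathcomp Require Import all_solvable.
From mathcomp Require Import boolp classical_sets functions.

Set Implicit Arguments.
Unset Strict Implicit.
Unset Printing Implicit Defensive.

Import GRing.Theory.

Local Open Scope classical_set_scope.
Local Open Scope ring_scope.

Section Subspace.
Variables (F : fieldType) (V : lmodType F).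
Implicit Types S X : set V.

Definition subspace S := S 0 /\ forall (a : F) u v, S u -> S v -> S (a *: u + v).

Definition linear_span X : set V := smallest subspace X.

Lemma subspace_span X : subspace (linear_span X).
Proof.
split; first by move=> S [[S0 _] _].
move=> a u v Xu Xv S SX; have [[_ Slin] _] := SX.
exact: Slin (Xu S SX) (Xv S SX).
Qed.

Definition subspace_pred S (_ : subspace S) : {pred V} := fun v => `[< S v >].

Record subspace_of S (hS : subspace S) := SubspaceOf {
  subspace_val : V;
  subspace_valP : subspace_val \in subspace_pred hS
}.

End Subspace.

Section SubspaceLmodule.
Variables (F : fieldType) (V : lmodType F) (S : set V) (hS : subspace S).

Fact subspace_pred_closed : subsemimod_closed (subspace_pred hS).
Proof.
have [S0 Slin] := hS.
split=> [|a u /asboolP Su].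
  split; first exact/asboolP.
  move=> u v /asboolP Su /asboolP Sv; apply/asboolP.
  by rewrite -[u]scale1r; exact: Slin.
by apply/asboolP; rewrite -[_ *: _]addr0; exact: Slin.
Qed.

HB.instance Definition _ :=
  GRing.isSubmodClosed.Build F V (subspace_pred hS) subspace_pred_closed.
HB.instance Definition _ := [isSub for @subspace_val F V S hS].
HB.instance Definition _ := [Choice of subspace_of hS by <:].
HB.instance Definition _ := [SubChoice_isSubLmodule of subspace_of hS by <:].

End SubspaceLmodule.

Section LieAlgebra.
Variables (F : fieldType) (V : lmodType F) (br : V -> V -> V).

Record lie_algebra : Prop := LieAlgebra {
  lie_bilinear : bilinear_for *:%R *:%R br;
  lie_alternating : forall x, br x x = 0;
  lie_jacobi : forall x y z, br x (br y z) + br y (br z x) + br z (br x y) = 0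
}.

Definition lie_subalgebra (L S : set V) :=
  [/\ S `<=` L, subspace S & forall x y, S x -> S y -> S (br x y)].

Definition lie_ideal (L I : set V) :=
  [/\ I `<=` L, subspace I & forall x y, L x -> I y -> I (br x y)].

Definition lie_automorphism (f : V -> V) :=
  [/\ linear f, bijective f & {morph f : x y / br x y}].

End LieAlgebra.

Section Gl.
Variables (F : fieldType) (A : lmodType F).

Definition endo_set : set (A -> A) := [set f | linear f].

Lemma subspace_endo : subspace endo_set.
Proof.
split=> [a u v|a f g flin glin b u v]; first by rewrite /= scaler0 addr0.
have -> x : (a *: f + g) x = a *: f x + g x by [].
rewrite flin glin !scalerDr !scalerA addrACA.
by rewrite [a * b]mulrC.
Qed.

Definition gl := subspace_of subspace_endo.
HB.instance Definition _ := GRing.Lmodule.on gl.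

Definition gl_fun (f : gl) : A -> A := val f.
Coercion gl_fun : gl >-> Funclass.

Lemma gl_linear (f : gl) : linear f.
Proof. exact/asboolP/(valP f). Qed.

Definition gl_br_fun (f g : gl) : A -> A := fun x => f (g x) - g (f x).

Fact gl_br_subproof (f g : gl) :
  gl_br_fun f g \in subspace_pred subspace_endo.
Proof.
apply/asboolP => a u v; rewrite /gl_br_fun !gl_linear.
by rewrite scalerBr opprD addrACA.
Qed.

Definition gl_br (f g : gl) : gl := SubspaceOf (gl_br_subproof f g).

Definition gl3 := 'Z_3 -> gl.
HB.instance Definition _ := GRing.Lmodule.on gl3.

Definition gl3_br (d e : gl3) : gl3 := fun i => gl_br (d i) (e i).

(* (d_0, d_1, d_2) |-> (d_2, d_0, d_1) *)
Definition theta (d : gl3) : gl3 := fun i => d (i - 1).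

End Gl.

Section NormalSTA.
Variables (F : fieldType) (A : lmodType F) (mul : A -> A -> A).

Definition stri : set (gl3 A) :=
  [set d | forall (i : 'Z_3) x y,
     d i (mul x y) = mul (d (i + 1) x) y + mul x (d (i + 2) y)].

Definition lmult (x : A) : A -> A := fun z => mul x z.
Definition rmult (x : A) : A -> A := fun z => mul z x.

Record normal_sta (delta : A -> A -> gl3 A) : Prop := NormalSTA {
  sta_mul_bilinear : bilinear_for *:%R *:%R mul;
  sta_delta_stri : forall x y, stri (delta x y);
  sta_delta_bilinear : bilinear_for *:%R *:%R delta;
  sta_delta_skew : forall x y, delta x y = - delta y x;
  sta_comm : forall (i j : 'Z_3) a b x y,
    gl_br (delta a b i) (delta x y j) =
    delta (delta a b (i - j) x) y j + delta x (delta a b (i - j) y) j;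
  sta_cyclic : forall x y z,
    delta x (mul y z) 0 + delta y (mul z x) (- 1) + delta z (mul x y) (- 2) = 0;
  sta_jacobi : forall x y z,
    delta x y 0 z + delta y z 0 x + delta z x 0 y = 0;
  sta_delta1 : forall x y,
    delta x y 1 =1 (rmult y \o lmult x) \- (rmult x \o lmult y);
  sta_delta2 : forall x y,
    delta x y 2 =1 (lmult y \o rmult x) \- (lmult x \o rmult y)
}.

End NormalSTA.

Section GAlgebra.
Variables (F : fieldType) (A : lmodType F) (delta : A -> A -> gl3 A).

Definition delta_span : set (gl3 A) :=
  linear_span [set d | exists x y, d = delta x y].

Definition theta_delta (i : 'Z_3) : set (gl3 A) :=
  [set iter i (@theta F A) d | d in delta_span].

Definition t_set : set (gl3 A) :=
  [set \sum_(i : 'Z_3) e i | e in [set e : 'Z_3 -> gl3 A |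
                                    forall i, theta_delta i (e i)]].

Lemma subspace_theta_delta i : subspace (theta_delta i).
Proof.
have thetaP n a (u v : gl3 A) :
  iter n (@theta F A) (a *: u + v) =
  a *: iter n (@theta F A) u + iter n (@theta F A) v.
  by elim: n => //= n ->.
have [S0 Slin] := subspace_span [set d | exists x y, d = delta x y].
split=> [|a _ _ [u Su <-] [v Sv <-]].
  by exists 0 => //; elim: (nat_of_ord i) => //= n ->.
by exists (a *: u + v); [exact: Slin | exact: thetaP].
Qed.

Lemma subspace_t : subspace t_set.
Proof.
split=> [|a _ _ [e eP <-] [f fP <-]].
  exists (fun _ => 0); last by rewrite big1.
  by move=> i; have [] := subspace_theta_delta i.
exists (fun i => a *: e i + f i).
  by move=> i; have [_] := subspace_theta_delta i; apply.
by rewrite big_split scaler_sumr.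
Qed.

Definition t_alg := subspace_of subspace_t.
HB.instance Definition _ := GRing.Lmodule.on t_alg.

Definition t_val (d : t_alg) : gl3 A := val d.

Definition g_alg := (t_alg * ('Z_3 -> A))%type.
HB.instance Definition _ := GRing.Lmodule.on g_alg.

Definition inT (d : t_alg) : g_alg := (d, 0).

Definition iotaA (i : 'Z_3) (x : A) : g_alg :=
  (0, fun j => if j == i then x else 0).

(* In particular [d] lies in t. *)
Definition is_inT (u : g_alg) (d : gl3 A) :=
  exists2 f : t_alg, t_val f = d & u = inT f.

Record g_multiplication (mul : A -> A -> A) (br : g_alg -> g_alg -> g_alg) :
    Prop := GMultiplication {
  g_bilinear : bilinear_for *:%R *:%R br;
  g_anticomm : forall u v, br u v = - br v u;
  g_tt : forall d e,
    is_inT (br (inT d) (inT e)) (gl3_br (t_val d) (t_val e));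
  g_ti : forall d i x, br (inT d) (iotaA i x) = iotaA i (t_val d i x);
  g_ij : forall i x y, br (iotaA i x) (iotaA (i + 1) y) = iotaA (i + 2) (mul x y);
  g_ii : forall i x y,
    is_inT (br (iotaA i x) (iotaA i y)) (iter i (@theta F A) (delta x y))
}.

End GAlgebra.

(* The point [k] of {1,2,3,4} is the ordinal of value [k - 1]. *)
Definition pt (k : nat) : 'I_4 := inord k.-1.

(* [(s * t)%g] applies [s] first; this is composition from right to left. *)
Definition perm_comp (s t : {perm 'I_4}) : {perm 'I_4} := (t * s)%g.

Definition tau1 : {perm 'I_4} :=
  perm_comp (tperm (pt 1) (pt 2)) (tperm (pt 3) (pt 4)).
Definition tau2 : {perm 'I_4} :=
  perm_comp (tperm (pt 2) (pt 3)) (tperm (pt 1) (pt 4)).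
Definition phi : {perm 'I_4} :=
  perm_comp (tperm (pt 1) (pt 2)) (tperm (pt 2) (pt 3)).

Lemma phiE : [/\ phi (pt 1) = pt 2, phi (pt 2) = pt 3, phi (pt 3) = pt 1
                & phi (pt 4) = pt 4].
Proof.
by split; rewrite permM !permE /=; apply/val_inj; rewrite -!val_eqE /= !inordK.
Qed.

Section A4Action.
Variables (F : fieldType) (A : lmodType F) (delta : A -> A -> gl3 A).
Let g := g_alg delta.

Definition A4_embedding (br : g -> g -> g) (rho : {perm 'I_4} -> g -> g) :=
  [/\ forall s, s \in Alt 'I_4 -> lie_automorphism br (rho s),
      forall s t, s \in Alt 'I_4 -> t \in Alt 'I_4 ->
        rho (perm_comp s t) =1 rho s \o rho t
    & forall s t, s \in Alt 'I_4 -> t \in Alt 'I_4 ->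
        rho s =1 rho t -> s = t].

Record A4_generator_rules (rho : {perm 'I_4} -> g -> g) : Prop :=
    A4GeneratorRules {
  tau1_t : forall d, rho tau1 (inT d) = inT d;
  tau2_t : forall d, rho tau2 (inT d) = inT d;
  phi_t : forall d : t_alg delta, is_inT (rho phi (inT d)) (theta (t_val d));
  phi_iota : forall i x, rho phi (iotaA delta i x) = iotaA delta (i + 1) x;
  tau1_iota0 : forall x, rho tau1 (iotaA delta 0 x) = iotaA delta 0 x;
  tau1_iota12 : forall (i : 'Z_3) x, i \in [:: 1; 2] ->
    rho tau1 (iotaA delta i x) = - iotaA delta i x;
  tau2_iota1 : forall x, rho tau2 (iotaA delta 1 x) = iotaA delta 1 x;
  tau2_iota02 : forall (i : 'Z_3) x, i \in [:: 0; 2] ->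
    rho tau2 (iotaA delta i x) = - iotaA delta i x
}.

End A4Action.

(* Main.v *)
Require Import Defs.
From mathcomp Require Import all_boot all_order all_algebra all_fingroup.
From mathcomp Require Import all_solvable.
From mathcomp Require Import boolp classical_sets functions.

Set Implicit Arguments.
Unset Strict Implicit.
Unset Printing Implicit Defensive.

Import GRing.Theory.

Local Open Scope ring_scope.

(* Writing an element of g as (d, x) with d in t and x = (x_0, x_1, x_2), put
   (d.x)_j = d_j(x_j), D(x, y) = sum_i theta^i(delta(x_i, y_i)) and
   (x o y)_j = x_{j+1} * y_{j+2} - y_{j+1} * x_{j+2}.  Then
     [(d, x), (e, y)] = ([d, e] + D(x, y), d.y - e.x + x o y),
   and the Jacobi identity splits into: [d, D(x, y)] = D(d.x, y) + D(x, d.y),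
   which is axiom (i); d acts on o by derivations, since t lies in stri;
   the cyclic sum of D(x, y o z) vanishes by axiom (ii); and the cyclic sum of
   x o (y o z) - D(y, z).x vanishes by axioms (iii), (iv) and (v).

   An element of A_4 acts by (d, x) |-> (theta^k d, j |-> +-x_{j-k}).  Such a
   map preserves the bracket as soon as the product of the three signs is 1. *)

(** * Additivity of maps known only through [linear] *)

Section LinearFor.
Variables (F : fieldType) (U V : lmodType F) (f : U -> V) (flin : linear f).

Lemma linear_for_add : {morph f : x y / x + y}.
Proof. by move=> x y; rewrite -[x in LHS]scale1r flin scale1r. Qed.

Lemma linear_for0 : f 0 = 0.
Proof. by apply: (addrI (f 0)); rewrite -linear_for_add !addr0. Qed.

Lemma linear_for_opp : {morph f : x / - x}.
Proof.
by move=> x; apply: (addrI (f x)); rewrite -linear_for_add !subrr linear_for0.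
Qed.

Lemma linear_for_sub : {morph f : x y / x - y}.
Proof. by move=> x y; rewrite linear_for_add linear_for_opp. Qed.

Lemma linear_for_subD x y z : f (x - y + z) = f x - f y + f z.
Proof. by rewrite linear_for_add linear_for_sub. Qed.

Lemma linear_for_sum (I : finType) (x : I -> U) :
  f (\sum_i x i) = \sum_i f (x i).
Proof. exact: (big_morph f linear_for_add linear_for0). Qed.

End LinearFor.

(** * Minimality of linear spans, and sums in a subspace *)

Section LinearSpan.
Variables (F : fieldType) (V : lmodType F).
Implicit Types S X : set V.

Lemma sub_linear_span X x : X x -> linear_span X x.
Proof. by move=> Xx S [_]; apply. Qed.

Lemma linear_span_min X S :
  subspace S -> (forall x, X x -> S x) -> forall x, linear_span X x -> S x.
Proof. by move=> Ssub XS x /(_ S); apply; split. Qed.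

Lemma subspace_sum S (I : finType) (x : I -> V) :
  subspace S -> (forall i, S (x i)) -> S (\sum_i x i).
Proof.
move=> [S0 Slin] Sx; apply: big_ind => // u v Su Sv.
by rewrite -[u]scale1r; exact: Slin.
Qed.

End LinearSpan.

(** * The componentwise Lie bracket on triples, and the powers of [theta] *)

Section Gl3.
Variables (F : fieldType) (A : lmodType F).
Implicit Types d e f : gl3 A.

Lemma gl3P d e : (forall i x, d i x = e i x) -> d = e.
Proof.
by move=> de; apply: funext => i; apply/val_inj/funext => x; exact: de.
Qed.

Lemma gl30E i x : (0 : gl3 A) i x = 0. Proof. reflexivity. Qed.
Lemma gl3DE d e i x : (d + e) i x = d i x + e i x. Proof. by []. Qed.
Lemma gl3NE d i x : (- d) i x = - d i x. Proof. by []. Qed.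
Lemma gl3ZE a d i x : (a *: d) i x = a *: d i x. Proof. by []. Qed.

Lemma gl3_sumE (I : finType) (G : I -> gl3 A) i x :
  (\sum_k G k) i x = \sum_k G k i x.
Proof. exact: (big_morph (fun d : gl3 A => d i x)). Qed.

Lemma gl3_brE d e i x : gl3_br d e i x = d i (e i x) - e i (d i x).
Proof. by []. Qed.

Lemma gl_add (g : gl A) : {morph g : x y / x + y}.
Proof. exact: linear_for_add (gl_linear g). Qed.

Lemma gl_opp (g : gl A) : {morph g : x / - x}.
Proof. exact: linear_for_opp (gl_linear g). Qed.

Lemma gl3_br_linearr d : linear (gl3_br d).
Proof.
move=> a e f; apply: gl3P => i x.
rewrite !(gl3_brE, gl3DE, gl3ZE) gl_linear opprD addrACA.
by rewrite scalerBr.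
Qed.

Lemma gl3_brC d e : gl3_br d e = - gl3_br e d.
Proof. by apply: gl3P => i x; rewrite gl3NE !gl3_brE opprB. Qed.

Lemma gl3_br_linearl d : linear (fun e => gl3_br e d).
Proof.
by move=> a e f; rewrite /= !(gl3_brC _ d) gl3_br_linearr opprD scalerN.
Qed.

Lemma gl3_br_jacobi d e f :
  gl3_br d (gl3_br e f) + gl3_br e (gl3_br f d) + gl3_br f (gl3_br d e) = 0.
Proof.
apply: gl3P => i x; rewrite !(gl3DE, gl3_brE) !(gl_add, gl_opp) !opprB.
(* The twelve triple composites cancel in pairs; the pattern places each beside its opposite. *)
rewrite (AC (((2*2)*(2*2))*(2*2))
  ((1*12)*(2*7)*(3*10)*(4*5)*(6*11)*(8*9)))/=.
by rewrite !(subrr, addNr, addr0).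
Qed.

Lemma iter_thetaE n d : iter n (@theta F A) d = fun j => d (j - n%:R).
Proof.
elim: n => [|n IHn]; apply: funext => j /=; first by rewrite subr0.
by rewrite IHn /theta -natr1 opprD addrA addrAC.
Qed.

Lemma iter_theta_ordE (k : 'Z_3) d :
  iter k (@theta F A) d = fun j => d (j - k).
Proof. by rewrite iter_thetaE natr_Zp. Qed.

End Gl3.

(** * Index arithmetic and sums over Z_3 *)

Section Z3.
Implicit Type j : 'Z_3.

Lemma addZ3_11 j : j + 1 + 1 = j + 2.
Proof. by rewrite -addrA. Qed.

Lemma addZ3_12 j : j + 1 + 2 = j.
Proof. by rewrite -addrA (_ : 1 + 2 = 0) ?addr0 //; exact/val_inj. Qed.

Lemma addZ3_21 j : j + 2 + 1 = j.
Proof. by rewrite addrAC addZ3_12. Qed.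

Lemma addZ3_22 j : j + 2 + 2 = j + 1.
Proof. by rewrite -addZ3_11 addZ3_21. Qed.

Definition addZ3E := (addZ3_11, addZ3_12, addZ3_21, addZ3_22).

Lemma subZ3_1 j : j - (j + 1) = 2.
Proof. by rewrite opprD addrA subrr add0r; exact/val_inj. Qed.

Lemma subZ3_2 j : j - (j + 2) = 1.
Proof. by rewrite opprD addrA subrr add0r; exact/val_inj. Qed.

(** Translation by [j] permutes Z_3, so the sum may start at any index. Starting it at the component
    being evaluated leaves only the fixed shifts 0, 1 and 2. *)
Lemma big_Z3 (V : nmodType) (G : 'Z_3 -> V) j :
  \sum_i G i = G j + G (j + 1) + G (j + 2).
Proof.
rewrite (reindex_inj (addrI j)) !big_ord_recr big_ord0 /= add0r.
congr (G _ + G (j + _) + G (j + _)); [|exact: val_inj|exact: val_inj].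
by rewrite -[RHS]addr0; congr (j + _); exact: val_inj.
Qed.

Lemma big_Z3_shift (V : nmodType) (G : 'Z_3 -> V) k :
  \sum_i G (i + k) = \sum_i G i.
Proof. by rewrite [RHS](reindex_inj (addIr k)). Qed.

End Z3.

(** * The Lie algebra t, and the identities behind the Jacobi identity of g *)

Section Triality.
Variables (F : fieldType) (A : lmodType F) (mul : A -> A -> A).
Variables (delta : A -> A -> gl3 A) (Asta : normal_sta mul delta).
Implicit Types (d e f : gl3 A) (x y z : 'Z_3 -> A) (a b c : A).

Let mulDl b : {morph mul^~ b : a c / a + c}.
Proof. exact: linear_for_add ((sta_mul_bilinear Asta).1 b). Qed.
Let mulDr a : {morph mul a : b c / b + c}.
Proof. exact: linear_for_add ((sta_mul_bilinear Asta).2 a). Qed.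
Let mulNl b : {morph mul^~ b : a / - a}.
Proof. exact: linear_for_opp ((sta_mul_bilinear Asta).1 b). Qed.
Let mulNr a : {morph mul a : b / - b}.
Proof. exact: linear_for_opp ((sta_mul_bilinear Asta).2 a). Qed.

Definition thdelta (k : 'Z_3) a b : gl3 A := iter k (@theta F A) (delta a b).

Lemma thdeltaE k a b i : thdelta k a b i = delta a b (i - k).
Proof. by rewrite /thdelta iter_theta_ordE. Qed.

Lemma thdeltaC k a b : thdelta k a b = - thdelta k b a.
Proof.
apply: funext => i; rewrite -[RHS]/(- thdelta k b a i).
by rewrite !thdeltaE (sta_delta_skew Asta).
Qed.

Lemma thdelta_linearr k a : linear (thdelta k a).
Proof.
move=> r b c; apply: funext => i.
rewrite -[RHS]/(r *: thdelta k a b i + thdelta k a c i) !thdeltaE.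
by rewrite (sta_delta_bilinear Asta).2.
Qed.

(** The preimage of [P] under the [k]-th power of [theta] is again a subspace, so the minimality of
    the span delta(A, A) applies to it. *)
Lemma theta_delta_ind k (P : set (gl3 A)) : subspace P ->
  (forall a b, P (thdelta k a b)) -> forall d, theta_delta delta k d -> P d.
Proof.
move=> [P0 Plin] Pgen _ [d dspan <-].
apply: (linear_span_min (S := fun d => P (iter k (@theta F A) d))) dspan.
  split=> [|r u v]; first by rewrite iter_theta_ordE.
  by rewrite !iter_theta_ordE; exact: Plin.
by move=> _ [a [b ->]]; exact: Pgen.
Qed.

Lemma theta_delta_gen k a b : theta_delta delta k (thdelta k a b).
Proof. by exists (delta a b) => //; apply: sub_linear_span; exists a, b. Qed.

Lemma theta_delta_sub_t k d : theta_delta delta k d -> t_set delta d.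
Proof.
move=> dk; exists (fun i => if i == k then d else 0); last first.
  by rewrite -big_mkcond big_pred1_eq.
move=> i; case: eqP => [-> //|_].
by have [] := subspace_theta_delta delta i.
Qed.

Lemma t_set_ind (P : set (gl3 A)) : subspace P ->
  (forall k a b, P (thdelta k a b)) -> forall d, t_set delta d -> P d.
Proof.
move=> Psub Pgen _ [e eP <-]; apply: subspace_sum => // k.
by apply: theta_delta_ind (eP k).
Qed.

(** The triality relations are linear in [d], and [theta] permutes them cyclically; hence they pass
    from [delta a b] to every [thdelta k a b], and then to t. *)
Lemma stri_t d : t_set delta d -> stri mul d.
Proof.
apply: t_set_ind.
  split=> [i a b|r u v uP vP i a b].
    by rewrite !gl30E -[0]/(0 : A) (linear_for0 ((sta_mul_bilinear Asta).1 _))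
      (linear_for0 ((sta_mul_bilinear Asta).2 _)) addr0.
  rewrite !(gl3DE, gl3ZE) uP vP (sta_mul_bilinear Asta).1.
  by rewrite (sta_mul_bilinear Asta).2 scalerDr addrACA.
move=> k a b i a' b'; rewrite !thdeltaE (sta_delta_stri Asta).
by rewrite ![i - k + _]addrAC.
Qed.

(** Both sides are linear in [d], so [d] may be taken of the form [thdelta m p q], where the claim
    is axiom (i) read in each component. *)
Lemma br_thdelta d k a b : t_set delta d ->
  gl3_br d (thdelta k a b) = thdelta k (d k a) b + thdelta k a (d k b).
Proof.
move=> dt; move: d dt k a b; apply: t_set_ind.
  split=> [k a b|r u v uP vP k a b].
    rewrite (linear_for0 (gl3_br_linearl _)) thdeltaC.
    rewrite !(linear_for0 (thdelta_linearr _ _)).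
    by rewrite oppr0 addr0.
  rewrite (gl3_br_linearl _) uP vP.
  rewrite !(thdeltaC k _ b) (gl3DE _ _ k a) (gl3DE _ _ k b).
  rewrite !(thdelta_linearr _ _ r) opprD addrACA.
  by rewrite scalerDr scalerN.
move=> m p q k a b; apply: funext => i.
rewrite [LHS]/gl3_br !thdeltaE (sta_comm Asta).
(* The index difference in axiom (i) does not depend on [i]: it always selects component [k] of
   [thdelta m p q]. *)
rewrite (_ : i - m - (i - k) = k - m); last by rewrite opprB addrC addrA subrK.
by rewrite -!thdeltaE.
Qed.

(** By [br_thdelta], bracketing a generator of index [k] with an element of t gives a sum of two
    generators of the same index. *)
Lemma theta_delta_ideal k :
  lie_ideal (@gl3_br F A) (t_set delta) (theta_delta delta k).
Proof.
split; [exact: theta_delta_sub_t | exact: subspace_theta_delta |].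
move=> d e dt; have [S0 Slin] := subspace_theta_delta delta k.
apply: (theta_delta_ind (P := fun e => theta_delta delta k (gl3_br d e))).
  split=> [|r u v uP vP]; first by rewrite (linear_for0 (gl3_br_linearr _)).
  by rewrite gl3_br_linearr; exact: Slin.
move=> a b; rewrite br_thdelta // -[thdelta k (d k a) b]scale1r.
by apply: Slin; exact: theta_delta_gen.
Qed.

(** Closure under the bracket follows by splitting the second argument into its summands, each lying
    in one of the ideals. *)
Lemma t_subalgebra : lie_subalgebra (@gl3_br F A) (stri mul) (t_set delta).
Proof.
split; [exact: stri_t | exact: subspace_t |].
move=> d _ dt [e eP <-].
rewrite (linear_for_sum (gl3_br_linearr d)).
apply: subspace_sum (subspace_t delta) _ => k.
apply: theta_delta_sub_t; have [_ _] := theta_delta_ideal k; exact.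
Qed.

Definition gl3_act d x : 'Z_3 -> A := fun j => d j (x j).

Definition circ x y : 'Z_3 -> A :=
  fun j => mul (x (j + 1)) (y (j + 2)) - mul (y (j + 1)) (x (j + 2)).

Definition dsum x y : gl3 A := \sum_k thdelta k (x k) (y k).

Lemma dsum_t x y : t_set delta (dsum x y).
Proof.
apply: subspace_sum (subspace_t delta) _ => k.
exact: theta_delta_sub_t (theta_delta_gen _ _ _).
Qed.

Lemma circC x y : circ x y = - circ y x.
Proof. by apply: funext => j; rewrite [RHS]opprB. Qed.

Lemma circ_linearr x : linear (circ x).
Proof.
move=> r y z; apply: funext => j; rewrite /circ.
rewrite [mul (x _) _](sta_mul_bilinear Asta).2.
rewrite [mul ((_ *: _ + _) _) _](sta_mul_bilinear Asta).1 opprD addrACA.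
by rewrite -scalerBr.
Qed.

Lemma dsumC x y : dsum x y = - dsum y x.
Proof. by rewrite -sumrN; apply: eq_bigr => k _; rewrite thdeltaC. Qed.

Lemma dsum_linearr x : linear (dsum x).
Proof.
move=> r y z; rewrite scaler_sumr -big_split /=.
by apply: eq_bigr => k _; rewrite thdelta_linearr.
Qed.

Lemma gl3_act_linearr d : linear (gl3_act d).
Proof. by move=> r x y; apply: funext => j; rewrite /gl3_act gl_linear. Qed.

Lemma gl3_act_linearl x : linear (gl3_act^~ x).
Proof. by []. Qed.

Lemma gl3_act_br d e x :
  gl3_act (gl3_br d e) x = gl3_act d (gl3_act e x) - gl3_act e (gl3_act d x).
Proof. by []. Qed.

Lemma br_dsum d x y : t_set delta d ->
  gl3_br d (dsum x y) = dsum (gl3_act d x) y + dsum x (gl3_act d y).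
Proof.
move=> dt; rewrite (linear_for_sum (gl3_br_linearr d)) -big_split /=.
by apply: eq_bigr => k _; rewrite br_thdelta.
Qed.

Lemma gl3_act_circ d x y : stri mul d ->
  gl3_act d (circ x y) = circ (gl3_act d x) y + circ x (gl3_act d y).
Proof.
move=> dS; apply: funext => j; rewrite /gl3_act gl_add gl_opp !dS.
by rewrite [X in _ - X]addrC opprD addrACA.
Qed.

(** Axiom (ii) only concerns the components 0, -1 and -2. Applying it to the three cyclic rotations
    of the arguments yields the relation [cyc] at every component [i]. *)
Lemma thdelta_cyclic k a b c :
  thdelta k a (mul b c) + thdelta (k + 1) b (mul c a)
    + thdelta (k + 2) c (mul a b) = 0.
Proof.
have cyc (i : 'Z_3) u v w : delta u (mul v w) i + delta v (mul w u) (i - 1)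
    + delta w (mul u v) (i - 2) = 0.
  case: i => [[|[|[|//]]] lt_i].
  - rewrite (_ : Ordinal lt_i = 0); last exact: val_inj.
    by rewrite !sub0r; exact: (sta_cyclic Asta).
  - rewrite (_ : Ordinal lt_i = 1); last exact: val_inj.
    rewrite subrr (_ : 1 - 2 = - 1); last exact: val_inj.
    have <- := sta_cyclic Asta v w u; rewrite (_ : - 2 = 1); last exact: val_inj.
    by rewrite -[LHS]addrA [LHS]addrC.
  rewrite (_ : Ordinal lt_i = - 1); last exact: val_inj.
  rewrite (_ : - 1 - 2 = 0); last exact: val_inj.
  rewrite (_ : - 1 - 1 = - 2); last exact: val_inj.
  by rewrite addrC addrA (sta_cyclic Asta).
apply: funext => i; rewrite -[RHS](cyc (i - k) a b c) -!addrA -!opprD.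
rewrite -[LHS]/(thdelta _ _ _ i + (thdelta _ _ _ i + thdelta _ _ _ i)).
by rewrite !thdeltaE.
Qed.

Lemma dsum_circ_cyclic x y z :
  dsum x (circ y z) + dsum y (circ z x) + dsum z (circ x y) = 0.
Proof.
(* [E u v w] is the contribution to [dsum u (circ v w)] of the first product in [circ]; the second
   product contributes [- E u w v]. *)
pose E u v w : gl3 A := \sum_k thdelta k (u k) (mul (v (k + 1)) (w (k + 2))).
have E_cyclic u v w : E u v w + E v w u + E w u v = 0.
  (* Shifting the second and third sums by 1 and 2 aligns the products, so that each [k] gives one
     instance of [thdelta_cyclic]. *)
  rewrite -[E v w u](big_Z3_shift _ 1) -[E w u v](big_Z3_shift _ 2).
  rewrite -!big_split /=.
  by apply: big1 => k _; rewrite !addZ3E thdelta_cyclic.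
have dsumE u v w : dsum u (circ v w) = E u v w - E u w v.
  rewrite -sumrB; apply: eq_bigr => k _.
  by rewrite (linear_for_sub (thdelta_linearr _ _)).
rewrite !dsumE (AC (2*2*2) ((1*3*5)*(2*6*4)))/=.
by rewrite -!opprD !E_cyclic subrr.
Qed.

(** At component [j], the summands of [dsum] with index [j], [j + 1] and [j + 2] act through
    delta_0, delta_2 and delta_1. Axioms (iv) and (v) turn the last two into products, which cancel
    against those of the iterated [circ]. *)
Lemma gl3_act_dsum_cyclic x y z :
  circ x (circ y z) - gl3_act (dsum y z) x
    + (circ y (circ z x) - gl3_act (dsum z x) y)
    + (circ z (circ x y) - gl3_act (dsum x y) z) = 0.
Proof.
have dsumE u v w j : gl3_act (dsum u v) w j = delta (u j) (v j) 0 (w j)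
    + (mul (v (j + 1)) (mul (w j) (u (j + 1)))
       - mul (u (j + 1)) (mul (w j) (v (j + 1))))
    + (mul (mul (u (j + 2)) (w j)) (v (j + 2))
       - mul (mul (v (j + 2)) (w j)) (u (j + 2))).
  rewrite /gl3_act gl3_sumE (big_Z3 _ j) !thdeltaE subrr subZ3_1 subZ3_2.
  by rewrite (sta_delta1 Asta) (sta_delta2 Asta).
have circE u v w j : circ u (circ v w) j =
    mul (u (j + 1)) (mul (v j) (w (j + 1)))
    - mul (u (j + 1)) (mul (w j) (v (j + 1)))
    - mul (mul (v (j + 2)) (w j)) (u (j + 2))
    + mul (mul (w (j + 2)) (v j)) (u (j + 2)).
  by rewrite /circ !addZ3E mulDr mulNr mulDl mulNl opprD opprK addrA.
apply: funext => j.
rewrite -[LHS]/(_ - _ + (_ - _) + (_ - _)) !dsumE !circE.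
rewrite !(opprB, opprD).
(* Twelve pairs of opposite products, followed by the three delta_0 terms, which all carry a minus
   sign and vanish together by axiom (iii). *)
rewrite (AC ((4*(1*2*2))*(4*(1*2*2))*(4*(1*2*2)))
  ((1*16)*(2*24)*(3*26)*(4*18)*(6*11)*(7*19)*(8*12)*(9*22)*(10*25)*(13*27)
   *(15*20)*(17*21)*(5*14*23)))/=.
by rewrite !(subrr, addNr, addr0) add0r -!opprD (sta_jacobi Asta) oppr0.
Qed.

End Triality.

(** * Coordinates on g and uniqueness of its multiplication *)

Section GAlg.
Variables (F : fieldType) (A : lmodType F) (delta : A -> A -> gl3 A).
Implicit Types (u v w : g_alg delta).

Lemma t_alg_subproof (d : gl3 A) :
  t_set delta d -> d \in subspace_pred (subspace_t delta).
Proof. by move=> dt; apply/asboolP. Qed.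

Definition t_mk (d : gl3 A) (dt : t_set delta d) : t_alg delta :=
  SubspaceOf (t_alg_subproof dt).

Lemma t_valP (d : t_alg delta) : t_set delta (t_val d).
Proof. exact/asboolP/(valP d). Qed.

Lemma t_val_mk d (dt : t_set delta d) : t_val (t_mk dt) = d.
Proof. by []. Qed.

Lemma g_algP u v : t_val u.1 = t_val v.1 -> u.2 = v.2 -> u = v.
Proof.
by case: u v => [d x] [e y] /= de ->; congr (_, _); exact: val_inj.
Qed.

Lemma is_inT_inj u v d : is_inT u d -> is_inT v d -> u = v.
Proof.
move=> [e <- ->] [f fe ->]; congr inT; apply: val_inj.
by rewrite -[RHS]/(t_val f) fe.
Qed.

Lemma g_algE u : u = inT u.1 + \sum_i iotaA delta i (u.2 i).
Proof.
case: u => d x; congr (_, _) => /=.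
  rewrite (big_morph (fun u : g_alg delta => u.1) (id1 := 0) (op1 := +%R)) //.
  by rewrite big1 ?addr0.
apply: funext => j; rewrite [RHS]add0r.
rewrite (big_morph (fun u : g_alg delta => u.2 j) (id1 := 0) (op1 := +%R)) //=.
by rewrite -big_mkcond (big_pred1 j) // => i; rewrite eq_sym.
Qed.

Lemma linear_g_alg_ext (V : lmodType F) (f g : g_alg delta -> V) :
    linear f -> linear g -> (forall d, f (inT d) = g (inT d)) ->
    (forall i a, f (iotaA delta i a) = g (iotaA delta i a)) ->
  f =1 g.
Proof.
move=> flin glin fgT fgA u; rewrite (g_algE u).
rewrite (linear_for_add flin) (linear_for_add glin) fgT; congr (_ + _).
rewrite (linear_for_sum flin) (linear_for_sum glin).
by apply: eq_bigr => i _; exact: fgA.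
Qed.

(** Bilinearity reduces the claim to t and the copies of [A], which span g. Anticommutativity
    supplies the products whose factors come in the order that the rules do not list. *)
Lemma g_multiplication_unique mul br1 br2 :
  @g_multiplication F A delta mul br1 -> @g_multiplication F A delta mul br2 ->
  br1 =2 br2.
Proof.
move=> br1P br2P u v; move: u.
have swap br : g_multiplication mul br -> forall u v, br u v = - br v u.
  by case.
apply: linear_g_alg_ext.
- exact: (g_bilinear br1P).1.
- exact: (g_bilinear br2P).1.
- move=> d; move: v; apply: linear_g_alg_ext.
  + exact: (g_bilinear br1P).2.
  + exact: (g_bilinear br2P).2.
  + by move=> e; apply: is_inT_inj (g_tt br1P d e) (g_tt br2P d e).
  by move=> i a; rewrite (g_ti br1P) (g_ti br2P).
move=> i a; move: v; apply: linear_g_alg_ext.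
- exact: (g_bilinear br1P).2.
- exact: (g_bilinear br2P).2.
- by move=> e; rewrite (swap _ br1P) (swap _ br2P) (g_ti br1P) (g_ti br2P).
move=> j b; have [<-|] := eqVneq i j.
  by apply: is_inT_inj (g_ii br1P i a b) (g_ii br2P i a b).
(* Two distinct elements of Z_3 are consecutive in one of the two orders. *)
move=> ij; have : (j == i + 1) || (i == j + 1).
  by move: ij; case: i j => [[|[|[|//]]] ?] [[|[|[|//]]] ?].
case/orP => /eqP ->; first by rewrite (g_ij br1P) (g_ij br2P).
by rewrite (swap _ br1P) (swap _ br2P) (g_ij br1P) (g_ij br2P).
Qed.

End GAlg.

(** This is how the characteristic enters: it makes an anticommutative bracket alternating, and it
    separates a nonzero vector from its opposite in the faithfulness argument. *)
Lemma eq_opp0 (F : fieldType) (V : lmodType F) (v : V) :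
  2%N \notin [pchar F] -> v = - v -> v = 0.
Proof.
move=> charF vN; apply/eqP; have : 2%:R *: v = 0.
  by rewrite scaler_nat mulr2n [X in X + _]vN addNr.
move/eqP; rewrite scaler_eq0; case/orP => // two0.
by case/negP: charF; apply/andP.
Qed.

(** * The bracket on g and its Jacobi identity *)

Section GBracket.
Variables (F : fieldType) (A : lmodType F) (mul : A -> A -> A).
Variables (delta : A -> A -> gl3 A) (Asta : normal_sta mul delta).
Implicit Types (u v w : g_alg delta).

Fact g_br_subproof u v :
  t_set delta (gl3_br (t_val u.1) (t_val v.1) + dsum delta u.2 v.2).
Proof.
have [_ _ brt] := t_subalgebra Asta; have [_ Slin] := subspace_t delta.
rewrite -[gl3_br _ _]scale1r; apply: Slin; last exact: dsum_t.
by apply: brt; exact: t_valP.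
Qed.

Definition g_br u v : g_alg delta :=
  (t_mk (g_br_subproof u v),
   gl3_act (t_val u.1) v.2 - gl3_act (t_val v.1) u.2 + circ mul u.2 v.2).

Lemma g_brC u v : g_br u v = - g_br v u.
Proof.
apply: g_algP => /=.
  rewrite -[RHS]/(- (gl3_br (t_val v.1) (t_val u.1) + dsum delta v.2 u.2)).
  by rewrite t_val_mk gl3_brC (dsumC Asta) opprD.
rewrite -[RHS]/(- (gl3_act (t_val v.1) u.2 - gl3_act (t_val u.1) v.2 + circ mul v.2 u.2)).
by rewrite opprD opprB (circC mul u.2).
Qed.

Lemma g_br_linearr u : linear (g_br u).
Proof.
move=> r v w; apply: g_algP.
  rewrite -[RHS]/(r *: (gl3_br (t_val u.1) (t_val v.1) + dsum delta u.2 v.2)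
    + (gl3_br (t_val u.1) (t_val w.1) + dsum delta u.2 w.2)).
  rewrite scalerDr addrACA -gl3_br_linearr -(dsum_linearr Asta).
  by [].
rewrite -[RHS]/(r *: (gl3_act (t_val u.1) v.2 - gl3_act (t_val v.1) u.2 + circ mul u.2 v.2)
  + (gl3_act (t_val u.1) w.2 - gl3_act (t_val w.1) u.2 + circ mul u.2 w.2)).
rewrite scalerDr scalerBr addrACA -(circ_linearr Asta); congr (_ + _).
by rewrite addrACA -gl3_act_linearr -opprD -gl3_act_linearl.
Qed.

Lemma g_br_linearl u : linear (g_br^~ u).
Proof.
by move=> r v w; rewrite /= !(g_brC _ u) g_br_linearr opprD scalerN.
Qed.

Let mul0l b : mul 0 b = 0.
Proof. exact: linear_for0 ((sta_mul_bilinear Asta).1 b). Qed.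
Let mul0r a : mul a 0 = 0.
Proof. exact: linear_for0 ((sta_mul_bilinear Asta).2 a). Qed.
Let thdelta0r k a : thdelta delta k a 0 = 0.
Proof. exact: linear_for0 (thdelta_linearr Asta k a). Qed.
Let thdelta0l k a : thdelta delta k 0 a = 0.
Proof. by rewrite (thdeltaC Asta) thdelta0r oppr0. Qed.
Let gl0 (g : gl A) : g 0 = 0.
Proof. exact: linear_for0 (gl_linear g). Qed.

(** On two copies of [A], [dsum] pairs only equal indices and [circ] only distinct ones, so each
    rule retains a single term of the general formula. *)
Lemma g_br_multiplication : g_multiplication mul g_br.
Proof.
split.
- by split; [exact: g_br_linearl | exact: g_br_linearr].
- exact: g_brC.
- move=> d e; exists (g_br (inT d) (inT e)).1.
    rewrite t_val_mk /= /dsum big1 ?addr0 // => k _; exact: thdelta0r.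
  apply: g_algP => //; apply: funext => j.
  rewrite -[LHS]/(t_val d j 0 - t_val e j 0 + (mul 0 0 - mul 0 0)).
  by rewrite !gl0 mul0l !subrr addr0.
- move=> d i a; apply: g_algP.
    rewrite t_val_mk (linear_for0 (gl3_br_linearr _)) add0r.
    by rewrite /dsum big1 // => k _; exact: thdelta0l.
  apply: funext => j.
  rewrite -[LHS]/(t_val d j (if j == i then a else 0) - (0 : A)
    + (mul 0 (if j + 2 == i then a else 0) - mul (if j + 1 == i then a else 0) 0)).
  rewrite mul0l mul0r !subr0 addr0 /=.
  by case: eqP => [->|_] //; rewrite gl0.
- move=> i a b; apply: g_algP.
    rewrite t_val_mk (linear_for0 (gl3_br_linearr _)) add0r.
    rewrite /dsum big1 // => k _ /=; case: eqP => [->|_]; last exact: thdelta0l.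
    by rewrite (_ : (i == i + 1) = false) ?thdelta0r //; case: i => [[|[|[|//]]] ?].
  apply: funext => j; rewrite /= /circ.
  rewrite -[LHS]/((0 : A) - 0 + (mul (if j + 1 == i then a else 0)
     (if j + 2 == i + 1 then b else 0)
      - mul (if j + 1 == i + 1 then b else 0) (if j + 2 == i then a else 0))).
  (* Both factors of the first product are supported at [j = i + 2]; the second product would need
     [j = i] and [j + 2 = i] at once. *)
  rewrite subr0 add0r -addZ3_11 !(inj_eq (addIr _)).
  rewrite addZ3_11 (_ : (j + 1 == i) = (j == i + 2)); last first.
    by rewrite -[LHS](inj_eq (addIr 2)) addZ3_12.
  case: (eqVneq j (i + 2)) => [->|_]; last first.
    case: eqP => [->|_]; last by rewrite mul0l mul0l subr0.
    rewrite mul0l sub0r; case: eqP => [|_]; last by rewrite mul0r oppr0.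
    by case: i => [[|[|[|//]]] ?].
  rewrite (_ : (i + 2 == i) = false) ?mul0l ?subr0 //.
  by case: i => [[|[|[|//]]] ?].
move=> i a b; exists (g_br (iotaA delta i a) (iotaA delta i b)).1.
  rewrite t_val_mk (linear_for0 (gl3_br_linearr _)) add0r.
  rewrite /dsum (bigD1 i) //= eqxx big1 ?addr0 // => k /negPf ->.
  exact: thdelta0l.
apply: g_algP => //; apply: funext => j.
rewrite -[LHS]/((0 : A) - 0 + (mul (if j + 1 == i then a else 0)
   (if j + 2 == i then b else 0)
    - mul (if j + 1 == i then b else 0) (if j + 2 == i then a else 0))).
rewrite subr0 add0r -[RHS]/(0 : A).
case: eqP => [<-|_]; last by rewrite !mul0l subrr.
by rewrite (inj_eq (addrI j)) /= !mul0r subrr.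
Qed.

Lemma g_br_lie : 2%N \notin [pchar F] -> lie_algebra g_br.
Proof.
move=> charF; split.
- exact: g_bilinear g_br_multiplication.
- move=> u; apply: (eq_opp0 charF); exact: g_brC.
move=> [d x] [e y] [f z]; apply: g_algP.
  rewrite -[LHS]/(gl3_br (t_val d) (gl3_br (t_val e) (t_val f) + dsum delta y z)
      + dsum delta x (gl3_act (t_val e) z - gl3_act (t_val f) y + circ mul y z)
    + (gl3_br (t_val e) (gl3_br (t_val f) (t_val d) + dsum delta z x)
      + dsum delta y (gl3_act (t_val f) x - gl3_act (t_val d) z + circ mul z x))
    + (gl3_br (t_val f) (gl3_br (t_val d) (t_val e) + dsum delta x y)
      + dsum delta z (gl3_act (t_val d) y - gl3_act (t_val e) x + circ mul x y))).
  rewrite !(linear_for_add (gl3_br_linearr _)) !(br_dsum Asta) //; try exact: t_valP.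
  rewrite !(linear_for_subD (dsum_linearr Asta _)).
  (* Skew-symmetry brings the derivation terms to the shape of those produced by the other cyclic
     terms: the first becomes the opposite of [dsum z (gl3_act (t_val d) y)]. *)
  rewrite (dsumC Asta (gl3_act _ y) z) (dsumC Asta (gl3_act _ z) x).
  rewrite (dsumC Asta (gl3_act _ x) y).
  (* Six cancelling pairs, then the Jacobi sum of t and the cyclic sum of [dsum_circ_cyclic]. *)
  rewrite (AC (((1*2)*3)*((1*2)*3)*((1*2)*3))
    ((2*16)*(3*11)*(4*8)*(5*15)*(9*17)*(10*14)*(1*7*13)*(6*12*18)))/=.
  rewrite (gl3_br_jacobi (t_val d)) (dsum_circ_cyclic Asta x y z).
  by rewrite !(subrr, addNr, addr0).
have dS (h : t_alg delta) := stri_t Asta (t_valP h).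
rewrite -[LHS]/(gl3_act (t_val d) (gl3_act (t_val e) z - gl3_act (t_val f) y + circ mul y z)
    - (gl3_act (gl3_br (t_val e) (t_val f)) x + gl3_act (dsum delta y z) x)
    + circ mul x (gl3_act (t_val e) z - gl3_act (t_val f) y + circ mul y z)
  + (gl3_act (t_val e) (gl3_act (t_val f) x - gl3_act (t_val d) z + circ mul z x)
    - (gl3_act (gl3_br (t_val f) (t_val d)) y + gl3_act (dsum delta z x) y)
    + circ mul y (gl3_act (t_val f) x - gl3_act (t_val d) z + circ mul z x))
  + (gl3_act (t_val f) (gl3_act (t_val d) y - gl3_act (t_val e) x + circ mul x y)
    - (gl3_act (gl3_br (t_val d) (t_val e)) z + gl3_act (dsum delta x y) z)
    + circ mul z (gl3_act (t_val d) y - gl3_act (t_val e) x + circ mul x y))).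
rewrite !(linear_for_subD (gl3_act_linearr _)).
rewrite !(gl3_act_circ _ _ (dS _)) !gl3_act_br.
rewrite !(linear_for_subD (circ_linearr Asta _)).
rewrite (circC mul (gl3_act _ y) z) (circC mul (gl3_act _ z) x).
rewrite (circC mul (gl3_act _ x) y).
have oppBD (p q r : 'Z_3 -> A) : - (p - q + r) = q - p - r.
  by rewrite opprD opprB.
rewrite !oppBD.
(* Six pairs cancel because [gl3_act] is a representation, six more because t acts on [circ] by
   derivations; the last block is the sum in [gl3_act_dsum_cyclic]. *)
rewrite (AC ((2*2*3*3)*(2*2*3*3)*(2*2*3*3))
  ((1*26)*(2*15)*(3*28)*(4*19)*(5*22)*(6*11)*(8*13)*(9*24)*(12*25)*(14*29)
   *(16*21)*(18*23)*((10*7)*(20*17)*(30*27))))/=.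
rewrite (gl3_act_dsum_cyclic Asta x y z).
by rewrite !(subrr, addNr, addr0).
Qed.

End GBracket.

(** * A_4 acting on the three splittings of four points into pairs *)

Section Tetrahedron.
Implicit Types (s t : {perm 'I_4}) (j k l : 'Z_3) (p q : 'I_4).

(* The component [iota_j] corresponds to the splitting of {1,2,3,4} into the two
   orbits of the involution of A_4 that fixes [iota_j]; [block j] is the orbit
   containing the point 4.  When [s] carries the splitting of index [j - k] to
   that of index [j], [block_sign s j] tells whether the block containing 4 is
   sent to the other one: this is the sign with which [s] acts. *)
Definition block j p : bool := (p == 3 :> nat) || (p == (j + 2) %% 3 :> nat)%N.

Definition block_sign s j : bool := ~~ block j (s (pt 4)).

Definition rotates s k : bool :=
  [forall j, forall p, block j (s p) == block (j - k) p (+) block_sign s j].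

(** The default 0 matters only outside A_4, by [Alt4_rotates]. *)
Definition rotation s : 'Z_3 := odflt 0 [pick k | rotates s k].

Lemma rotatesP s k :
  reflect (forall j p, block j (s p) = block (j - k) p (+) block_sign s j)
          (rotates s k).
Proof.
apply: (iffP forallP) => [sk j p|sk j]; last by apply/forallP => p; exact/eqP.
by have /forallP /(_ p) /eqP := sk j.
Qed.

Lemma ord4P p : [\/ p = pt 1, p = pt 2, p = pt 3 | p = pt 4].
Proof.
case: p => [[|[|[|[|//]]]] ltp];
  [apply: Or41 | apply: Or42 | apply: Or43 | apply: Or44];
  by apply: val_inj; rewrite /= inordK.
Qed.

Lemma val_pt m : (m < 4)%N -> pt m.+1 = m :> nat.
Proof. exact: inordK. Qed.

Lemma pt_eq m n : (m < 4)%N -> (n < 4)%N -> (pt m.+1 == pt n.+1) = (m == n).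
Proof. by move=> m4 n4; rewrite -val_eqE /= !val_pt. Qed.

Lemma block_pt4 j : block j (pt 4).
Proof. by rewrite /block (val_pt (m := 3)). Qed.

Lemma block_inj p q : (forall j, block j p = block j q) -> p = q.
Proof.
move=> pq; move: (pq 0) (pq 1) (pq 2) => {pq}.
case: p q => [[|[|[|[|//]]]] ltp] [[|[|[|[|//]]]] ltq] //; rewrite /block //=;
  by move=> _ _ _; exact: val_inj.
Qed.

Lemma block_index_inj j k : block j =1 block k -> j = k.
Proof.
move=> jk; move: (jk (pt 1)) (jk (pt 2)) (jk (pt 3)) => {jk}.
rewrite /block !val_pt //.
by case: j k => [[|[|[|//]]] ltj] [[|[|[|//]]] ltk] //= _ _ _; exact: val_inj.
Qed.

(** Every point lies in an odd number of blocks: the point 4 in all three, any other point in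
    exactly one. *)
Lemma block_sum j p : block (j + 1) p (+) block (j + 2) p = ~~ block j p.
Proof. by case: j p => [[|[|[|//]]] ltj] [[|[|[|[|//]]]] ltp]. Qed.

(** The product of the three signs is 1, which is what [twist_br] requires. *)
Lemma block_sign_sum s j :
  block_sign s (j + 1) (+) block_sign s (j + 2) = block_sign s j.
Proof. by rewrite /block_sign addbN addNb negbK block_sum. Qed.

(** This cocycle rule is the relation defining [rotates s k], evaluated at the image of the point 4
    under [t]. *)
Lemma block_sign_comp s t k j : rotates s k ->
  block_sign (perm_comp s t) j = block_sign s j (+) block_sign t (j - k).
Proof.
by move=> /rotatesP sk; rewrite {1}/block_sign permM sk addbC -addbN.
Qed.

Lemma rotates_comp s t k l :
  rotates s k -> rotates t l -> rotates (perm_comp s t) (k + l).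
Proof.
move=> sk /rotatesP tl; move: (sk) => /rotatesP skE; apply/rotatesP => j p.
rewrite (block_sign_comp t j sk) permM skE tl opprD addrA -addbA.
by rewrite [block_sign t _ (+) _]addbC.
Qed.

Lemma rotates_uniq s k l : rotates s k -> rotates s l -> k = l.
Proof.
move=> /rotatesP sk /rotatesP sl; apply/oppr_inj/(addrI 0)/block_index_inj => p.
by have := sk 0 p; rewrite sl => /addIb.
Qed.

(** Rotation and signs determine which blocks contain the image of each point, and a point is known
    from its blocks. *)
Lemma rotates_inj s t k :
  rotates s k -> rotates t k -> block_sign s =1 block_sign t -> s = t.
Proof.
move=> /rotatesP sk /rotatesP tk st; apply/permP => p; apply: block_inj => j.
by rewrite sk tk st.
Qed.

Lemma rotationE s k : rotates s k -> rotation s = k.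
Proof.
move=> sk; rewrite /rotation; case: pickP => [l sl|/(_ k)]; last by rewrite sk.
exact: rotates_uniq sl sk.
Qed.

Lemma tau1E :
  [/\ tau1 (pt 1) = pt 2, tau1 (pt 2) = pt 1, tau1 (pt 3) = pt 4
    & tau1 (pt 4) = pt 3].
Proof. by split; rewrite permM !permE /= !pt_eq //= !pt_eq. Qed.

Lemma tau2E :
  [/\ tau2 (pt 1) = pt 4, tau2 (pt 2) = pt 3, tau2 (pt 3) = pt 2
    & tau2 (pt 4) = pt 1].
Proof. by split; rewrite permM !permE /= !pt_eq //= !pt_eq. Qed.

Lemma rotates1 : rotates 1%g 0.
Proof.
apply/rotatesP => j p.
by rewrite /block_sign !perm1 block_pt4 subr0 addbF.
Qed.

Lemma rotates_tau1 : rotates tau1 0.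
Proof.
have [t1 t2 t3 t4] := tau1E.
apply/rotatesP => j p; rewrite subr0 /block_sign t4.
by case: (ord4P p) => ->; rewrite ?t1 ?t2 ?t3 ?t4 /block !val_pt //;
  case: j => [[|[|[|//]]] ?].
Qed.

Lemma rotates_tau2 : rotates tau2 0.
Proof.
have [t1 t2 t3 t4] := tau2E.
apply/rotatesP => j p; rewrite subr0 /block_sign t4.
by case: (ord4P p) => ->; rewrite ?t1 ?t2 ?t3 ?t4 /block !val_pt //;
  case: j => [[|[|[|//]]] ?].
Qed.

Lemma rotates_phi : rotates phi 1.
Proof.
have [t1 t2 t3 t4] := phiE.
apply/rotatesP => j p; rewrite /block_sign t4.
by case: (ord4P p) => ->; rewrite ?t1 ?t2 ?t3 ?t4 /block !val_pt //;
  case: j => [[|[|[|//]]] ?].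
Qed.

(** The generators are even, so a count suffices: [tau1] and [tau2] generate a subgroup of order 4
    and [phi] has order 3, so 12, the order of A_4, divides that of the generated group. *)
Lemma Alt4_gen : Alt 'I_4 = <<[set tau1; tau2; phi]>>%g.
Proof.
have [a1 a2 a3 a4] := tau1E; have [b1 b2 b3 b4] := tau2E.
have [c1 c2 c3 c4] := phiE.
have perm4P s t : s (pt 1) = t (pt 1) -> s (pt 2) = t (pt 2) ->
    s (pt 3) = t (pt 3) -> s (pt 4) = t (pt 4) -> s = t.
  by move=> *; apply/permP => p; case: (ord4P p) => ->.
have o1 : #[tau1]%g = 2%N.
  apply: nt_prime_order => //.
    by apply: perm4P; rewrite expgS expg1 permM perm1 !(a1, a2, a3, a4).
  by apply/eqP => /permP /(_ (pt 1)) /eqP; rewrite perm1 a1 pt_eq.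
have o2 : #[tau2]%g = 2%N.
  apply: nt_prime_order => //.
    by apply: perm4P; rewrite expgS expg1 permM perm1 !(b1, b2, b3, b4).
  by apply/eqP => /permP /(_ (pt 1)) /eqP; rewrite perm1 b1 pt_eq.
have o3 : #[phi]%g = 3%N.
  apply: nt_prime_order => //.
    by apply: perm4P; rewrite 2!expgS expg1 2!permM perm1 !(c1, c2, c3, c4).
  by apply/eqP => /permP /(_ (pt 1)) /eqP; rewrite perm1 c1 pt_eq.
have tauC : commute tau1 tau2.
  by apply: perm4P; rewrite [LHS]permM [RHS]permM
    !(a1, a2, a3, a4, b1, b2, b3, b4).
(* A subgroup of prime order meets another trivially unless contained in it, and [tau1] is neither 1
   nor [tau2]. *)
have tauTI : (<[tau1]> :&: <[tau2]> = 1)%g.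
  apply: prime_TIg; first by rewrite -orderE o1.
  rewrite cycle_subG /= (cycle2g o2) !inE negb_or.
  apply/andP; split; apply/eqP => /permP /(_ (pt 1)) /eqP;
    by rewrite a1 ?perm1 ?b1 pt_eq.
set G := <<_>>%g.
have [tau1G tau2G phiG] : [/\ tau1 \in G, tau2 \in G & phi \in G].
  by split; apply: mem_gen; rewrite !inE eqxx ?orbT.
have G4 : (4 %| #|G|)%N.
  have o12 : #|(<[tau1]> * <[tau2]>)%g| = 4%N.
    by rewrite TI_cardMg // -!orderE o1 o2.
  rewrite -[X in (X %| _)%N]o12 -cent_joinEl; last first.
    by rewrite cent_cycle cycle_subG; exact/cent1P.
  by apply: cardSg; rewrite join_subG !cycle_subG tau1G.
have G3 : (3 %| #|G|)%N by rewrite -[X in (X %| _)%N]o3 order_dvdG.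
apply/esym/eqP; rewrite eqEcard gen_subG; apply/andP; split.
  apply/fintype.subsetP => s; rewrite Alt_even !inE => /orP[/orP[]|] /eqP ->;
    by rewrite odd_permM !odd_tperm !pt_eq.
have := card_Alt (T := 'I_4); rewrite card_ord => /(_ isT) cardA.
rewrite -(leq_pmul2l (isT : 0 < 2)%N) cardA.
rewrite -[4`!]/(2 * 12)%N leq_pmul2l //; apply: dvdn_leq => //.
by rewrite (@Gauss_dvd 4 3) // G4.
Qed.

(** The permutations that rotate the splittings form a subgroup, so checking the three generators is
    enough. *)
Lemma Alt4_rotates s : s \in Alt 'I_4 -> rotates s (rotation s).
Proof.
suff {s} sub : Alt 'I_4 \subset [set s | rotates s (rotation s)].
  by move=> /(fintype.subsetP sub); rewrite inE.
have rotM : group_set [set s | rotates s (rotation s)].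
  apply/group_setP; split=> [|s t].
    by rewrite inE (rotationE rotates1) rotates1.
  (* The group product applies [s] first, so it is [perm_comp t s]; hence the reversed order. *)
  rewrite !inE => sk tk; have st := rotates_comp tk sk.
  by rewrite (rotationE st).
rewrite Alt4_gen -[[set s | _]]/(gval (Group rotM)) gen_subG.
apply/fintype.subsetP => s; rewrite !inE => /orP[/orP[]|] /eqP ->.
- by rewrite (rotationE rotates_tau1) rotates_tau1.
- by rewrite (rotationE rotates_tau2) rotates_tau2.
by rewrite (rotationE rotates_phi) rotates_phi.
Qed.

End Tetrahedron.

(** * Signed rotations of g and the action of A_4 *)

Section Twist.
Variables (F : fieldType) (A : lmodType F) (mul : A -> A -> A).
Variables (delta : A -> A -> gl3 A) (Asta : normal_sta mul delta).
Implicit Types (u v w : g_alg delta) (k l : 'Z_3) (b c : 'Z_3 -> bool).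

Lemma iter_theta_linear k : linear (iter k (@theta F A)).
Proof. by move=> r d e; rewrite !iter_theta_ordE. Qed.

Lemma iter_theta_thdelta k l x y :
  iter k (@theta F A) (thdelta delta l x y) = thdelta delta (l + k) x y.
Proof.
rewrite /thdelta !iter_theta_ordE; apply: funext => j.
by rewrite opprD addrA addrAC.
Qed.

Lemma t_set_iter_theta k d :
  t_set delta d -> t_set delta (iter k (@theta F A) d).
Proof.
apply: (t_set_ind (P := fun d => t_set delta (iter k (@theta F A) d))).
  have [t0 tlin] := subspace_t delta.
  split=> [|r u v]; first by rewrite (linear_for0 (iter_theta_linear k)).
  by rewrite iter_theta_linear; exact: tlin.
move=> l x y; rewrite iter_theta_thdelta.
exact: theta_delta_sub_t (theta_delta_gen _ _ _ _).
Qed.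

Definition vtwist k b (x : 'Z_3 -> A) : 'Z_3 -> A :=
  fun j => (-1) ^+ b j *: x (j - k).

Definition twist k b u : g_alg delta :=
  (t_mk (t_set_iter_theta k (t_valP u.1)), vtwist k b u.2).

Lemma vtwist_linear k b : linear (vtwist k b).
Proof.
move=> r x y; apply: funext => j.
rewrite -[RHS]/(r *: (_ *: x (j - k)) + _ *: y (j - k)).
by rewrite scalerA mulrC -scalerA -scalerDr.
Qed.

Lemma twist_linear k b : linear (twist k b).
Proof.
move=> r u v; apply: g_algP; last exact: vtwist_linear.
rewrite t_val_mk.
rewrite -[RHS]/(r *: iter k (@theta F A) (t_val u.1)
  + iter k (@theta F A) (t_val v.1)).
by rewrite -iter_theta_linear.
Qed.

Lemma twist_comp k l b c u :
  twist k b (twist l c u) = twist (k + l) (fun j => b j (+) c (j - k)) u.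
Proof.
apply: g_algP.
  rewrite !t_val_mk !iter_theta_ordE; apply: funext => j.
  by rewrite opprD addrA.
apply: funext => j; rewrite /= /vtwist scalerA -signr_addb opprD addrA.
by [].
Qed.

Lemma twist0 b u : b =1 xpred0 -> twist 0 b u = u.
Proof.
move=> b0; apply: g_algP.
  by rewrite t_val_mk iter_theta_ordE; apply: funext => j; rewrite subr0.
by apply: funext => j; rewrite /= /vtwist b0 scale1r subr0.
Qed.

Lemma twist_inT k b d :
  is_inT (twist k b (inT d)) (iter k (@theta F A) (t_val d)).
Proof.
exists (twist k b (inT d)).1; first by rewrite t_val_mk.
by apply: g_algP => //; exact: (linear_for0 (vtwist_linear k b)).
Qed.

Lemma twist_iota k b i a :
  twist k b (iotaA delta i a) = (-1) ^+ b (i + k) *: iotaA delta (i + k) a.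
Proof.
apply: g_algP.
  rewrite -[RHS]/(_ *: (0 : gl3 A)) scaler0.
  exact: linear_for0 (iter_theta_linear k).
apply: funext => j; rewrite /= /vtwist.
rewrite -[RHS]/(_ *: (if j == i + k then a else 0)).
by rewrite subr_eq; case: eqP => [->|_] //; rewrite !scaler0.
Qed.

Let mulZl (r : F) x y : mul (r *: x) y = r *: mul x y.
Proof.
have mullin := (sta_mul_bilinear Asta).1 y.
by rewrite -[r *: x]addr0 mullin (linear_for0 mullin) addr0.
Qed.
Let mulZr (r : F) x y : mul x (r *: y) = r *: mul x y.
Proof.
have mullin := (sta_mul_bilinear Asta).2 x.
by rewrite -[r *: y]addr0 mullin (linear_for0 mullin) addr0.
Qed.
Let glZ (g : gl A) (r : F) x : g (r *: x) = r *: g x.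
Proof.
by rewrite -[r *: x]addr0 gl_linear (linear_for0 (gl_linear g)) addr0.
Qed.

(** Each summand pairs two components of equal index, so the sign occurs twice and disappears,
    whatever [b] is. *)
Lemma dsum_vtwist k b x y :
  dsum delta (vtwist k b x) (vtwist k b y) =
    iter k (@theta F A) (dsum delta x y).
Proof.
rewrite (linear_for_sum (iter_theta_linear k)) -[LHS](big_Z3_shift _ k).
apply: eq_bigr => l _; rewrite iter_theta_thdelta /vtwist addrK.
have thZr (r : F) p q :
    thdelta delta (l + k) p (r *: q) = r *: thdelta delta (l + k) p q.
  have thlin := thdelta_linearr Asta (l + k) p.
  by rewrite -[r *: q]addr0 thlin (linear_for0 thlin) addr0.
rewrite thZr (thdeltaC Asta) thZr (thdeltaC Asta _ (y l)).
by rewrite !scalerN opprK scalerA -signr_addb addbb scale1r.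
Qed.

(** Component [j] of [circ] multiplies components [j + 1] and [j + 2], so the product of their signs
    must be the sign at [j]. *)
Lemma circ_vtwist k b x y : (forall j, b (j + 1) (+) b (j + 2) = b j) ->
  circ mul (vtwist k b x) (vtwist k b y) = vtwist k b (circ mul x y).
Proof.
move=> bP; apply: funext => j; rewrite /circ /vtwist.
rewrite !mulZl !mulZr !scalerA -!signr_addb !bP.
by rewrite scalerBr ![j + _ - k]addrAC.
Qed.

Lemma gl3_act_vtwist k b d x :
  gl3_act (iter k (@theta F A) d) (vtwist k b x) = vtwist k b (gl3_act d x).
Proof.
by rewrite iter_theta_ordE; apply: funext => j; rewrite /gl3_act /vtwist glZ.
Qed.

Lemma twist_br k b : (forall j, b (j + 1) (+) b (j + 2) = b j) ->
  {morph twist k b : u v / g_br Asta u v}.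
Proof.
move=> bP u v; apply: g_algP.
  rewrite !t_val_mk dsum_vtwist (linear_for_add (iter_theta_linear k)).
  by congr (_ + _); rewrite !iter_theta_ordE.
rewrite /= !t_val_mk !gl3_act_vtwist circ_vtwist //.
by rewrite (linear_for_subD (vtwist_linear k b)).
Qed.

Definition A4_act (s : {perm 'I_4}) : g_alg delta -> g_alg delta :=
  twist (rotation s) (block_sign s).

Lemma A4_act_comp s t : s \in Alt 'I_4 -> t \in Alt 'I_4 ->
  A4_act (perm_comp s t) =1 A4_act s \o A4_act t.
Proof.
move=> /Alt4_rotates sk /Alt4_rotates tl u; rewrite /= /A4_act twist_comp.
rewrite (rotationE (rotates_comp sk tl)); congr (twist _ _ u).
by apply: funext => j; rewrite (block_sign_comp t j sk).
Qed.

Lemma A4_act1 : A4_act 1%g =1 id.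
Proof.
move=> u; rewrite /A4_act (rotationE rotates1) twist0 // => j.
by rewrite /block_sign perm1 block_pt4.
Qed.

Lemma A4_act_automorphism s :
  s \in Alt 'I_4 -> lie_automorphism (g_br Asta) (A4_act s).
Proof.
move=> sA; have sVA : s^-1%g \in Alt 'I_4 by rewrite groupV.
split; [exact: twist_linear | | exact: twist_br (block_sign_sum s)].
by exists (A4_act s^-1%g) => u; rewrite -[LHS]A4_act_comp // /perm_comp;
  rewrite ?mulgV ?mulVg A4_act1.
Qed.

(** The image of a nonzero [a] in one copy reveals the rotation by the copy where it lands, and the
    sign there because [a] differs from [- a]. *)
Lemma A4_act_faithful s t :
    2%N \notin [pchar F] -> (exists a : A, a != 0) ->
  s \in Alt 'I_4 -> t \in Alt 'I_4 -> A4_act s =1 A4_act t -> s = t.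
Proof.
move=> charF [a a0] /Alt4_rotates sk /Alt4_rotates tl st.
have stE i : (-1) ^+ block_sign s (i + rotation s) *: a =
    (-1) ^+ block_sign t (i + rotation s) *:
       (if i + rotation s == i + rotation t then a else 0).
  have := congr1 (fun u : g_alg delta => u.2 (i + rotation s))
    (st (iotaA delta i a)).
  rewrite /A4_act /= /vtwist /= addrK eqxx subr_eq.
  by [].
have rot_st : rotation s = rotation t.
  have := stE 0; rewrite !add0r; case: eqP => // _ /eqP.
  by rewrite scaler0 scaler_eq0 signr_eq0 (negPf a0).
apply: (rotates_inj sk); first by rewrite rot_st.
move=> j; have := stE (j - rotation s); rewrite -rot_st eqxx subrK.
have aN : a != - a by apply: contraNneq a0 => /(eq_opp0 charF) ->.
case: (block_sign s j) (block_sign t j) => [] [] //;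
  rewrite !expr1 !scaleN1r !scale1r.
  by move=> /esym /eqP; rewrite (negPf aN).
by move=> /eqP; rewrite (negPf aN).
Qed.

(** The signs are read off the image of the point 4. It is 3 under [tau1] and 1 under [tau2], which
    lie only in the blocks of index 0 and 1 respectively; [phi] fixes 4 and has no signs. *)
Lemma A4_act_generators : A4_generator_rules A4_act.
Proof.
have [a1 a2 a3 a4] := tau1E; have [b1 b2 b3 b4] := tau2E.
have [c1 c2 c3 c4] := phiE.
have act_t s d : rotation s = 0 -> A4_act s (inT d) = inT d.
  move=> s0; apply: is_inT_inj (twist_inT _ _ d) _.
  by rewrite s0; exists d.
have tau1_0 := rotationE rotates_tau1; have tau2_0 := rotationE rotates_tau2.
split.
- by move=> d; exact: act_t.
- by move=> d; exact: act_t.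
- by move=> d; rewrite /A4_act (rotationE rotates_phi); exact: twist_inT.
- move=> i a; rewrite /A4_act (rotationE rotates_phi) twist_iota.
  by rewrite /block_sign c4 block_pt4 scale1r.
- move=> a; rewrite /A4_act tau1_0 twist_iota addr0.
  by rewrite /block_sign a4 /block val_pt // scale1r.
- move=> i a; rewrite /A4_act tau1_0 twist_iota addr0 !inE => /orP[] /eqP ->;
    by rewrite /block_sign a4 /block val_pt // scaleN1r.
- move=> a; rewrite /A4_act tau2_0 twist_iota addr0.
  by rewrite /block_sign b4 /block val_pt // scale1r.
move=> i a; rewrite /A4_act tau2_0 twist_iota addr0 !inE => /orP[] /eqP ->;
  by rewrite /block_sign b4 /block val_pt // scaleN1r.
Qed.

End Twist.

Theorem theorem1p14 (F : fieldType) (A : lmodType F) (mul : A -> A -> A)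
    (delta : A -> A -> gl3 A) (charF : 2%N \notin [pchar F])
    (A_neq0 : exists x : A, x != 0) (Asta : normal_sta mul delta) :
  [/\ lie_subalgebra (@gl3_br F A) (stri mul) (t_set delta),
      forall i : 'Z_3,
        lie_ideal (@gl3_br F A) (t_set delta) (theta_delta delta i)
    & exists br : g_alg delta -> g_alg delta -> g_alg delta,
        [/\ g_multiplication mul br,
            forall br', g_multiplication mul br' -> br' =2 br,
            lie_algebra br
          & exists rho : {perm 'I_4} -> g_alg delta -> g_alg delta,
              A4_embedding br rho /\ A4_generator_rules rho]].
Proof.
have brP := g_br_multiplication Asta.
split; [exact: t_subalgebra Asta | exact: theta_delta_ideal Asta |].
exists (g_br Asta); split; [exact: brP | | exact: g_br_lie |].
  by move=> br' br'P; exact: g_multiplication_unique br'P brP.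
exists (@A4_act F A delta); split; last exact: A4_act_generators.
split; [exact: A4_act_automorphism | exact: A4_act_comp |].
by move=> s t; exact: A4_act_faithful.
Qed.
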